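(* Let $\Gamma$ be a distance-regular graph with classical parameters $(D,b,\alpha,\beta)$ such that $b\ge2$, $b-1\ge\alpha\ge1$ and $D\ge3$, geometric with respect to a set $\mathcal C$ of Delsarte cliques (so $\Gamma$ is the point graph of the partial linear space $(V(\Gamma),\mathcal C,\in)$; members of $\mathcal C$ are called lines). Let $r=[D]$. Assume $\Gamma$ satisfies the dual Pasch axiom. Let $\ell$ be a line, $M$ an assembly and $u$ a vertex not in $M$. Then: (1) if $\ell\cap M\ne\emptyset$, then $|\ell\cap M|=\alpha+1$; (2) if $u$ has a neighbour in $M$, then $u$ has exactly $\alpha+1$ neighbours in $M$ and exactly one line through $u$ intersects $M$. Consequently, for every vertex $x$ the local graph at $x$ is the $\alpha$-clique extension of a $\frac{\beta}{\alpha}\times r$-grid.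
   Context: Distance-regular graph with intersection numbers $b_i,c_i$, valency $k=b_0$. For integer $b\ne1$, $[j]=\frac{b^j-1}{b-1}$. Classical parameters $(D,b,\alpha,\beta)$: diameter $D$, $b_i=([D]-[i])(\beta-\alpha[i])$, $c_i=[i](1+\alpha[i-1])$. A Delsarte clique is a clique with $1+\frac{k}{-\theta_{\min}}$ vertices, $\theta_{\min}$ the smallest adjacency eigenvalue; geometric with respect to $\mathcal C$ means every edge lies in exactly one member of $\mathcal C$. Dual Pasch axiom: for any two adjacent vertices $x,y$, the set of common neighbours of $x$ and $y$ not on the line through $x$ and $y$ is a clique. An assembly is a maximal clique of $\Gamma$ not in $\mathcal C$. The local graph at $x$ is the subgraph induced on the neighbours of $x$. The $m\times n$-grid is $K_m\Box K_n$; the $s$-clique extension of a graph $\Delta$ replaces each vertex $x$ by an $s$-clique $\tilde X$, with $u\in\tilde X$, $v\in\tilde Y$ ($\tilde X\ne\tilde Y$) adjacent iff $x\sim y$ in $\Delta$. *)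

(* Defs.v *)
From HB Require Import structures.
From mathcomp Require Import all_boot all_order all_algebra.
From mathcomp Require Import algC.
Set Implicit Arguments. Unset Strict Implicit. Unset Printing Implicit Defensive.
Import Order.TTheory GRing.Theory Num.Theory.
Local Open Scope ring_scope.

Section Graphs.
Variable n : nat.
Implicit Types (e : rel 'I_n) (x y : 'I_n) (A : {set 'I_n}).

Definition simple_graph e := symmetric e /\ irreflexive e.

Fixpoint ball e x (k : nat) : {set 'I_n} :=
  if k is k'.+1 then ball e x k' :|: [set z | [exists y in ball e x k', e y z]]
  else [set x].

Definition dist_is e x y (i : nat) : bool :=
  (y \in ball e x i) && (if i is i'.+1 then y \notin ball e x i' else true).

Definition sphere e x i : {set 'I_n} := [set y | dist_is e x y i].

Definition distance_regular e (D : nat) (bi ci : nat -> nat) :=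
  [/\ simple_graph e,
      (forall x y, y \in ball e x D),
      (exists x y, dist_is e x y D),
      (forall x y i, (i <= D)%N -> dist_is e x y i ->
          #|[set z in sphere e x i.+1 | e y z]| = bi i) &
      (forall x y i, (1 <= i <= D)%N -> dist_is e x y i ->
          #|[set z in sphere e x i.-1 | e y z]| = ci i)].

Definition gbr (b j : nat) : nat := \sum_(i < j) b ^ i.

Definition classical_params (D b : nat) (alpha beta : rat) (bi ci : nat -> nat) :=
  (forall i, (i <= D)%N ->
     (bi i)%:R = ((gbr b D)%:R - (gbr b i)%:R) * (beta - alpha * (gbr b i)%:R) :> rat) /\
  (forall i, (1 <= i <= D)%N ->
     (ci i)%:R = (gbr b i)%:R * (1 + alpha * (gbr b i.-1)%:R) :> rat).

Definition clique e A := [forall u in A, forall v in A, (u != v) ==> e u v].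

Definition adjmx e : 'M[algC]_n := \matrix_(i, j) (e i j)%:R.

Definition smallest_eigenvalue e (theta : algC) :=
  eigenvalue (adjmx e) theta /\ (forall a, eigenvalue (adjmx e) a -> theta <= a).

Definition delsarte_clique e (k : nat) A :=
  clique e A /\
  exists theta, smallest_eigenvalue e theta /\
     (#|A|)%:R = 1 + k%:R / (- theta) :> algC.

Definition geometric e (k : nat) (CC : {set {set 'I_n}}) :=
  (forall L, L \in CC -> delsarte_clique e k L) /\
  (forall x y, e x y -> exists! L, L \in CC /\ x \in L /\ y \in L).

Definition dual_pasch e (CC : {set {set 'I_n}}) :=
  forall x y, e x y -> forall L, L \in CC -> x \in L -> y \in L ->
    clique e [set z | e x z && e y z && (z \notin L)].

Definition maximal_clique e A :=
  clique e A /\ forall B, clique e B -> A \subset B -> B = A.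

Definition assembly e (CC : {set {set 'I_n}}) A := maximal_clique e A /\ A \notin CC.

Definition grid_adj m r (p q : 'I_m * 'I_r) : bool :=
  ((p.1 == q.1) && (p.2 != q.2)) || ((p.1 != q.1) && (p.2 == q.2)).

Definition local_is_clique_ext_grid e x (s m r : nat) :=
  exists f : 'I_m * 'I_r * 'I_s -> 'I_n,
    [/\ injective f,
        (forall y, e x y <-> exists u, f u = y) &
        (forall u v, e (f u) (f v) =
           (u != v) && ((u.1 == v.1) || grid_adj u.1 v.1))].

End Graphs.

(* Main.v *)
Require Import Defs.
From HB Require Import structures.
From mathcomp Require Import all_boot all_order all_algebra.
From mathcomp Require Import algC ring.
Import Order.TTheory GRing.Theory Num.Theory.

(* The distance regular graph enters only through the eigenvalue [- gbr b D].
   Its standard sequence alternates in sign, which by a Perron-Frobenius argument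
   makes it the smallest eigenvalue.  Hence lines have [1 + beta] points, every
   point is on [gbr b D] lines, and the standard vectors sum to zero on every
   line; the last fact says that a point off a line with a neighbour on it has
   exactly [alpha + 1] neighbours there.

   The rest is local.  If [y] and [z] are adjacent neighbours of [x] on different
   lines through [x], then the dual Pasch axiom and the equality of cardinals
   force [y] and [z] to have the same neighbours on every other line through [x].
   So the local graph splits into classes meeting each line through [x] in
   [alpha] points, adjacency across lines being membership in the same class:
   this is the clique extension of a grid, and its maximal cliques are the
   lines and the classes. *)

(** * Local graphs under the dual Pasch axiom *)

Section LocalStructure.
#[local] Set Implicit Arguments.
#[local] Unset Strict Implicit.

Variables (n : nat) (e : rel 'I_n) (CC : {set {set 'I_n}}) (a q r : nat).
Hypotheses (e_sym : symmetric e) (e_irr : irreflexive e).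
Hypothesis line_clique : forall L, L \in CC -> clique e L.
Hypothesis line_card : forall L, L \in CC -> #|L| = q.+1.
Hypothesis line_ex :
  forall x y, e x y -> exists2 L, L \in CC & (x \in L) && (y \in L).
Hypothesis line_uniq : forall x y L L', e x y -> L \in CC -> L' \in CC ->
  x \in L -> y \in L -> x \in L' -> y \in L' -> L = L'.
Hypothesis line_nbrs : forall L x, L \in CC -> x \notin L ->
  (exists2 y, y \in L & e x y) -> #|[set z in L | e x z]| = a.+1.
Hypothesis a_gt0 : 0 < a.
Hypothesis lines_through : forall x, #|[set L in CC | x \in L]| = r.
Hypothesis r_gt2 : 2 < r.
Hypothesis dualpasch : dual_pasch e CC.

Implicit Types (x y z w p : 'I_n) (L M : {set 'I_n}).

(** * Lines through a point and the traces of its neighbours *)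

Lemma edge_neq x y : e x y -> x != y.
Proof. by apply: contraTneq => ->; rewrite e_irr. Qed.

Lemma cliqueP M x y : clique e M -> x \in M -> y \in M -> x != y -> e x y.
Proof.
by move=> /forall_inP cM xM yM xy; move/forall_inP: (cM x xM) => /(_ y yM)/implyP; apply.
Qed.

Lemma line_edge L x y : L \in CC -> x \in L -> y \in L -> x != y -> e x y.
Proof. by move=> /line_clique; apply: cliqueP. Qed.

Lemma lines_meet x y L L' : e x y -> L \in CC -> L' \in CC -> L != L' ->
  x \in L -> x \in L' -> y \in L -> y \notin L'.
Proof.
move=> exy LC LC' neL xL xL' yL; apply: contraNN neL => yL'.
by rewrite (line_uniq exy LC LC').
Qed.

(** With three lines through [x], two neighbours of [x] can be compared on a line containing neither
    of them. Applied to [set0] twice, it merely yields a line through [x]. *)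
Lemma third_line x L1 L2 : exists L, [/\ L \in CC, x \in L, L != L1 & L != L2].
Proof.
have: 0 < #|[set L in CC | x \in L] :\ L1 :\ L2|.
  have := lines_through x; rewrite (cardsD1 L1) (cardsD1 L2 (_ :\ _)) => E.
  rewrite lt0n; apply: contraL r_gt2 => /eqP E0.
  by rewrite -E E0; do 2!case: (_ \in _).
case/card_gt0P=> L; rewrite !inE => /and4P[n2 n1 LC xL].
by exists L; split.
Qed.

Definition trace y L := [set p in L | e y p].

Lemma card_trace x y L : e x y -> L \in CC -> x \in L -> y \notin L ->
  #|trace y L| = a.+1.
Proof. by move=> exy LC xL yL; apply: line_nbrs => //; exists x; rewrite // e_sym. Qed.

Lemma trace_pick x y L : e x y -> L \in CC -> x \in L -> y \notin L ->
  exists p, [/\ p \in L, e x p & e y p].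
Proof.
move=> exy LC xL yL; have := card_trace exy LC xL yL.
rewrite (cardsD1 x) => E.
have: 0 < #|trace y L :\ x|.
  by rewrite -(ltn_add2l (x \in trace y L)) E addn0; case: (_ \in _).
case/card_gt0P=> p; rewrite !inE => /and3P[px pL eyp].
by exists p; split=> //; apply: (line_edge LC) => //; rewrite eq_sym.
Qed.

Lemma dual_paschE x y z w L : L \in CC -> x \in L -> y \in L -> e x y ->
  z \notin L -> w \notin L -> e x z -> e y z -> e x w -> e y w -> z != w -> e z w.
Proof.
move=> LC xL yL exy zL wL exz eyz exw eyw.
by apply: (cliqueP (dualpasch exy LC xL yL)); rewrite inE ?exz ?eyz ?exw ?eyw.
Qed.

(** A point [p != x] of [trace y L] and [z] are common neighbours of [x] and [y] off [Ly], hence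
    adjacent by dual Pasch. This gives one inclusion, and both traces have [a.+1] points. *)
Lemma trace_eq x y z L Ly : e x y -> e x z -> e y z -> L \in CC -> x \in L ->
  y \notin L -> z \notin L -> Ly \in CC -> x \in Ly -> y \in Ly -> z \notin Ly ->
  trace y L = trace z L.
Proof.
move=> exy exz eyz LC xL yL zL LyC xLy yLy zLy.
apply/eqP; rewrite eqEcard (card_trace exy) // (card_trace exz) // leqnn andbT.
apply/subsetP=> p; rewrite !inE => /andP[pL eyp]; rewrite pL /=.
have [->|px] := eqVneq p x; first by rewrite e_sym.
have exp : e x p by apply: (line_edge LC); rewrite // eq_sym.
have neL : L != Ly by apply: contraNneq yL => ->.
have pLy : p \notin Ly by apply: (lines_meet exp LC).
apply: (dual_paschE LyC xLy yLy) => //.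
by apply: contraNneq zL => ->.
Qed.

(* Neighbours of [x] are related when they see the same points on every line
   through [x] containing neither of them; the classes turn out to be the
   assemblies through [x] with [x] removed. *)
Definition loceq x y z :=
  [forall L in CC, [&& x \in L, y \notin L & z \notin L] ==> (trace y L == trace z L)].

Lemma loceqP x y z : reflect
  (forall L, L \in CC -> x \in L -> y \notin L -> z \notin L -> trace y L = trace z L)
  (loceq x y z).
Proof.
apply: (iffP forall_inP) => [H L LC xL yL zL|H L LC].
  by have /implyP := H L LC; rewrite xL yL zL => /(_ isT)/eqP.
by apply/implyP=> /and3P[xL yL zL]; apply/eqP/H.
Qed.

(** An edge gives equal traces by [trace_eq]. Conversely, the common trace on a third line has a
    point [p != x], since [a > 0], and [y], [z] are common neighbours of [x] and [p] off that
    line. *)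
Lemma loceq_edge x y z Ly : e x y -> e x z -> Ly \in CC -> x \in Ly ->
  y \in Ly -> z \notin Ly -> loceq x y z = e y z.
Proof.
move=> exy exz LyC xLy yLy zLy; apply/loceqP/idP; last first.
  by move=> eyz L LC xL yL zL; apply: (trace_eq exy exz eyz LC xL _ _ LyC).
have [Lz LzC /andP[xLz zLz]] := line_ex exz.
have [L [LC xL ny nz]] := third_line x Ly Lz.
have yL : y \notin L by apply: (lines_meet exy LyC); rewrite // eq_sym.
have zL : z \notin L by apply: (lines_meet exz LzC); rewrite // eq_sym.
have [p [pL exp eyp]] := trace_pick exy LC xL yL.
move=> /(_ L LC xL yL zL) E.
have : p \in trace z L by rewrite -E !inE pL.
rewrite !inE pL /= => ezp.
apply: (dual_paschE LC xL pL) => //; rewrite 1?e_sym //.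
by apply: contraNneq zLy => <-.
Qed.

Lemma loceq_refl x : reflexive (loceq x).
Proof. by move=> y; apply/loceqP. Qed.

Lemma loceq_sym x : symmetric (loceq x).
Proof. by move=> y z; apply/loceqP/loceqP=> H L LC xL ? ?; rewrite (H L). Qed.

(** The delicate case is a line through the middle point [z], where the two hypotheses compare no
    traces. *)
Lemma loceq_trans x y z w : e x y -> e x z -> e x w ->
  loceq x y z -> loceq x z w -> loceq x y w.
Proof.
move=> exy exz exw Ryz Rzw; apply/loceqP=> L LC xL yL wL.
have [zL|zL] := boolP (z \in L); last first.
  by move/loceqP: Ryz => ->//; move/loceqP: Rzw => ->.
have ezy : e z y by rewrite -(loceq_edge exz exy LC xL zL yL) loceq_sym.
have ezw : e z w by rewrite -(loceq_edge exz exw LC xL zL wL).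
have [Ly LyC /andP[xLy yLy]] := line_ex exy.
(* If [y] and [w] are on different lines through [x], dual Pasch on [L] makes them adjacent and
   [trace_eq] applies. Otherwise a point [p] of a third line, adjacent to both, serves as
   intermediary. *)
have [wLy|wLy] := boolP (w \in Ly); last first.
  have yw : y != w by apply: contraNneq wLy => <-.
  have eyw : e y w by apply: (dual_paschE LC xL zL).
  exact: (trace_eq exy exw eyw LC xL yL wL LyC).
have [K [KC xK nL nLy]] := third_line x L Ly.
have zK : z \notin K by apply: (lines_meet exz LC); rewrite // eq_sym.
have yK : y \notin K by apply: (lines_meet exy LyC); rewrite // eq_sym.
have wK : w \notin K by apply: (lines_meet exw LyC); rewrite // eq_sym.
have [p [pK exp eyp]] := trace_pick exy KC xK yK.
have pL : p \notin L by apply: (lines_meet exp KC).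
have pLy : p \notin Ly by apply: (lines_meet exp KC).
have ewp : e w p.
  have : p \in trace w K.
    by move/loceqP: Rzw => <-//; move/loceqP: Ryz => <-//; rewrite inE pK.
  by rewrite inE pK.
rewrite (trace_eq exy exp eyp LC xL yL pL LyC) //.
by rewrite (trace_eq exw exp ewp LC xL wL pL LyC).
Qed.

Lemma loceq_rep x y L : e x y -> L \in CC -> x \in L ->
  exists p, [/\ e x p, loceq x y p & p \notin L].
Proof.
move=> exy LC xL; have [yL|yL] := boolP (y \in L); last by exists y; rewrite loceq_refl.
have [K [KC xK nL _]] := third_line x L L.
have yK : y \notin K by apply: (lines_meet exy LC); rewrite // eq_sym.
have [p [pK exp eyp]] := trace_pick exy KC xK yK.
have pL : p \notin L by apply: (lines_meet exp KC).
by exists p; rewrite (loceq_edge exy exp LC).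
Qed.

Definition loccell x y L := [set z in L | e x z && loceq x y z].

(** For a representative [p] of the class off [L], adjacency to [p] decides which neighbours of [x]
    on [L] are in the class, so the cell is [trace p L] without [x]. *)
Lemma card_loccell x y L : e x y -> L \in CC -> x \in L -> #|loccell x y L| = a.
Proof.
move=> exy LC xL; have [p [exp Ryp pL]] := loceq_rep exy LC xL.
suff ->: loccell x y L = trace p L :\ x.
  have := card_trace exp LC xL pL.
  by rewrite (cardsD1 x) inE xL e_sym exp add1n => -[].
apply/setP=> z; rewrite !inE; have [zL|] := boolP (z \in L); last by rewrite andbF.
have [->|zx] := eqVneq z x; first by rewrite e_irr.
have exz : e x z by apply: (line_edge LC); rewrite // eq_sym.
rewrite exz /= [RHS]e_sym -(loceq_edge exz exp LC xL zL pL) loceq_sym.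
apply/idP/idP; first by move=> Rzy; apply: (loceq_trans exz exy exp).
by move=> Rzp; apply: (loceq_trans exz exp exy Rzp); rewrite loceq_sym.
Qed.

Lemma loceq_clique x y z : e x y -> e x z -> loceq x y z -> y != z -> e y z.
Proof.
move=> exy exz Ryz nyz; have [Ly LyC /andP[xLy yLy]] := line_ex exy.
have [zLy|zLy] := boolP (z \in Ly); first exact: (line_edge LyC).
by rewrite -(loceq_edge exy exz LyC).
Qed.

(** A maximal clique that is not a line lies in no line, so it has points [y] and [z] on different
    lines through [x]. They are in one class, every further point of [M] joins it, and the class
    with [x] is a clique, so maximality forces equality. *)
Lemma assembly_loceq x M : assembly e CC M -> x \in M -> exists y,
  e x y /\ M = x |: [set z | e x z && loceq x y z].
Proof.
move=> [[cM maxM] MC] xM.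
have maxE K : clique e K -> M \subset K -> K = M by apply: maxM.
have eM z : z \in M -> z != x -> e x z.
  by move=> zM zx; apply: (cliqueP cM); rewrite // eq_sym.
have [L0 [L0C xL0 _ _]] := third_line x set0 set0.
have notin L : L \in CC -> x \in L -> exists2 z, z \in M & z \notin L.
  move=> LC xL; apply/subsetPn; apply: contraNN MC => ML.
  by rewrite -(maxE L (line_clique LC) ML).
have [y yM yL0] := notin L0 L0C xL0.
have yx : y != x by apply: contraNneq yL0 => ->.
have exy := eM y yM yx; exists y; split=> //.
have [Ly LyC /andP[xLy yLy]] := line_ex exy.
have [z zM zLy] := notin Ly LyC xLy.
have zx : z != x by apply: contraNneq zLy => ->.
have exz := eM z zM zx.
have yz : y != z by apply: contraNneq zLy => <-.
have Ryz : loceq x y z by rewrite (loceq_edge exy exz LyC) // (cliqueP cM).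
apply/esym/maxE.
  apply/forall_inP=> u uK; apply/forall_inP=> v vK; apply/implyP=> uv.
  move: uK vK; rewrite !inE.
  case/predU1P=> [ux|/andP[exu Ru]]; case/predU1P=> [vx|/andP[exv Rv]].
  - by rewrite ux vx eqxx in uv.
  - by rewrite ux.
  - by rewrite vx e_sym.
  apply: (loceq_clique exu exv) => //; apply: (loceq_trans exu exy exv) => //.
  by rewrite loceq_sym.
apply/subsetP=> w wM; rewrite !inE; have [//|wx] := eqVneq w x.
have exw := eM w wM wx; rewrite exw /=.
(* [loceq_edge] compares points of different lines, so a point of [Ly] is compared with [z] instead
   of [y]. *)
have [wLy|wLy] := boolP (w \in Ly).
  apply: (loceq_trans exy exz exw Ryz).
  rewrite loceq_sym (loceq_edge exw exz LyC) // (cliqueP cM) //.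
  by apply: contraNneq zLy => <-.
rewrite (loceq_edge exy exw LyC) // (cliqueP cM) //.
by apply: contraNneq wLy => <-.
Qed.

Lemma line_assembly L M : L \in CC -> assembly e CC M -> L :&: M != set0 ->
  #|L :&: M| = a.+1.
Proof.
move=> LC aM /set0Pn[x]; rewrite inE => /andP[xL xM].
have [y [exy ->]] := assembly_loceq aM xM.
rewrite (cardsD1 x) !inE xL eqxx /= add1n -(card_loccell exy LC xL).
congr _.+1; apply: eq_card => z; rewrite !inE.
by have [->|] := eqVneq z x; rewrite //= e_irr andbF.
Qed.

(** Seen from [w], a neighbour [z] of [u] in [M] off [L] would be in the same class as [u], which
    would put [u] in [M]. *)
Lemma assembly_nbrs_line M u w L : assembly e CC M -> u \notin M -> w \in M ->
  L \in CC -> u \in L -> w \in L -> [set z in M | e u z] = L :&: M.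
Proof.
move=> aM uM wM LC uL wL.
have uw : u != w by apply: contraNneq uM => ->.
have ewu : e w u by apply: (line_edge LC); rewrite // eq_sym.
have [y [ewy ME]] := assembly_loceq aM wM.
apply/setP=> z; rewrite !inE andbC; have [zM|] := boolP (z \in M); last by rewrite !andbF.
rewrite !andbT; apply/idP/idP => [euz|zL]; last first.
  by apply: (line_edge LC) => //; apply: contraNneq uM => ->.
apply: contraNT uM => zL.
have zw : z != w by apply: contraNneq zL => ->.
move: zM; rewrite ME !inE (negPf zw) /= => /andP[ewz Ryz].
rewrite ewu /=; apply/orP; right; apply: (loceq_trans ewy ewz ewu Ryz).
by rewrite loceq_sym (loceq_edge ewu ewz LC).
Qed.

Lemma assembly_nbrs M u : assembly e CC M -> u \notin M ->
  (exists2 w, w \in M & e u w) ->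
  #|[set w in M | e u w]| = a.+1 /\
  exists! L, L \in CC /\ u \in L /\ L :&: M != set0.
Proof.
move=> aM uM [w wM euw].
have [L LC /andP[uL wL]] := line_ex euw.
have LM : L :&: M != set0 by apply/set0Pn; exists w; rewrite inE wL.
have E := assembly_nbrs_line aM uM wM LC uL wL.
split; first by rewrite E line_assembly.
(* Where [K] meets [M] there is a neighbour of [u], and all those are on [L]. *)
exists L; split=> // K [KC [uK /set0Pn[z]]]; rewrite inE => /andP[zK zM].
have euz : e u z by apply: (line_edge KC) => //; apply: contraNneq uM => ->.
have : z \in [set z in M | e u z] by rewrite inE zM.
rewrite E inE => /andP[zL _].
exact: (line_uniq euz).
Qed.

(** * The local graph as a clique extension of a grid *)

Definition locclasses x := equivalence_partition (loceq x) [set y | e x y].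

Lemma loceq_equiv x : {in [set y | e x y] & &, equivalence_rel (loceq x)}.
Proof.
move=> y z w; rewrite !inE => exy exz exw; split; first exact: loceq_refl.
move=> Ryz; apply/idP/idP; last exact: loceq_trans.
by apply: loceq_trans => //; rewrite loceq_sym.
Qed.

Lemma locclasses_partition x : partition (locclasses x) [set y | e x y].
Proof. exact/equivalence_partitionP/loceq_equiv. Qed.

Lemma locclass_rep x B : B \in locclasses x ->
  exists2 y, e x y & B = [set z | e x z && loceq x y z].
Proof.
case/imsetP=> y; rewrite inE => exy ->; exists y => //.
by apply/setP=> z; rewrite !inE.
Qed.

Lemma locclass_line x B L : B \in locclasses x -> L \in CC -> x \in L ->
  #|B :&: L| = a.
Proof.
move=> /locclass_rep[y exy ->] LC xL; rewrite -(card_loccell exy LC xL).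
by apply: eq_card => z; rewrite !inE andbC.
Qed.

(** The classes cut the [q] points other than [x] of a line through [x] into cells of size [a]. This
    yields the side [beta / alpha] of the grid. *)
Lemma card_locclasses x : q = #|locclasses x| * a.
Proof.
have [L [LC xL _ _]] := third_line x set0 set0.
have := line_card LC; rewrite (cardsD1 x) xL add1n => /succn_inj <-.
have /and3P[/eqP cov tI _] := locclasses_partition x.
have LN z : z \in L :\ x -> z \in cover (locclasses x).
  rewrite cov !inE => /andP[zx zL].
  by apply: (line_edge LC); rewrite // eq_sym.
rewrite -sum1_card (partition_big (pblock (locclasses x)) [in locclasses x]) /=; last first.
  by move=> z /LN; apply: pblock_mem.
rewrite -sum_nat_const; apply: eq_bigr => B BC.
rewrite sum1_card -(locclass_line BC LC xL).
apply: eq_card => z; rewrite [LHS]inE /= [RHS]inE.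
apply/idP/idP => [/andP[zL /eqP <-]|/andP[zB zL]].
  by rewrite mem_pblock LN //=; case/setD1P: zL.
have : z \in cover (locclasses x) by apply/bigcupP; exists B.
rewrite (def_pblock tI BC zB) eqxx andbT in_setD1 zL andbT cov inE.
by rewrite eq_sym; apply: edge_neq.
Qed.

(** The coordinates of a neighbour of [x] are its class, its line through [x], and its rank in the
    intersection of the two. *)
Lemma local_grid x : local_is_clique_ext_grid e x a #|locclasses x| r.
Proof.
have /and3P[/eqP cov tI _] := locclasses_partition x.
set P := locclasses x in cov tI *.
pose lines := [set L in CC | x \in L].
pose B (i : 'I_#|P|) := nth set0 (enum P) i.
pose L (j : 'I_r) := nth set0 (enum lines) j.
have BP i : B i \in P by rewrite -mem_enum mem_nth // -cardE.
have Llines j : L j \in lines by rewrite -mem_enum mem_nth // -cardE lines_through.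
have LC j : L j \in CC by have := Llines j; rewrite inE => /andP[].
have xL j : x \in L j by have := Llines j; rewrite inE => /andP[].
have Binj : injective B.
  move=> i i' /eqP; rewrite nth_uniq -?cardE ?enum_uniq // => /eqP.
  exact: val_inj.
have Linj : injective L.
  move=> i i' /eqP; rewrite nth_uniq -?cardE ?lines_through ?enum_uniq // => /eqP.
  exact: val_inj.
have Bsurj C : C \in P -> exists i, B i = C.
  move=> CP; have lt : index C (enum P) < #|P| by rewrite cardE index_mem mem_enum.
  by exists (Ordinal lt); rewrite /B /= nth_index ?mem_enum.
have Lsurj K : K \in lines -> exists j, L j = K.
  move=> KP; have lt : index K (enum lines) < r.
    by rewrite -(lines_through x) cardE index_mem mem_enum.
  by exists (Ordinal lt); rewrite /L /= nth_index ?mem_enum.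
pose f (u : 'I_#|P| * 'I_r * 'I_a) := nth x (enum (B u.1.1 :&: L u.1.2)) u.2.
have cardBL i j : #|B i :&: L j| = a by apply: (locclass_line (BP i)).
have fBL u : f u \in B u.1.1 :&: L u.1.2.
  by rewrite -mem_enum mem_nth // -cardE cardBL.
have fB u : f u \in B u.1.1 by have := fBL u; rewrite inE => /andP[].
have fL u : f u \in L u.1.2 by have := fBL u; rewrite inE => /andP[].
have ef u : e x (f u).
  have : f u \in cover P by apply/bigcupP; exists (B u.1.1).
  by rewrite cov inE.
have same_class y i : y \in B i -> pblock P y = B i by apply: def_pblock.
have finj : injective f.
  move=> u v E.
  have E1 : u.1.1 = v.1.1.
    by apply: Binj; rewrite -(same_class _ _ (fB u)) E (same_class _ _ (fB v)).
  have E2 : u.1.2 = v.1.2.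
    by apply: Linj; apply: (line_uniq (ef u)); rewrite ?fL // E fL.
  move: u v E E1 E2 => [[i j] s] [[i' j'] s'] /= + Ei Ej; rewrite -Ei -Ej /f /=.
  move/eqP; rewrite nth_uniq -?cardE ?cardBL ?enum_uniq // => /eqP/val_inj -> //.
exists f; split=> // [y|u v].
  split=> [exy|[u <-]]; last exact: ef.
  have yP : y \in cover P by rewrite cov inE.
  have [i Bi] := Bsurj _ (pblock_mem yP).
  have [K KC /andP[xK yK]] := line_ex exy.
  have Kl : K \in lines by rewrite inE KC.
  have [j Lj] := Lsurj _ Kl.
  have yBL : y \in B i :&: L j by rewrite inE Bi mem_pblock yP Lj.
  have lt : index y (enum (B i :&: L j)) < a.
    by rewrite -(cardBL i j) cardE index_mem mem_enum.
  by exists (i, j, Ordinal lt); rewrite /f /= nth_index ?mem_enum.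
have [<-|uv] := eqVneq u v; first by rewrite e_irr.
rewrite /grid_adj -[u.1 == v.1]/((u.1.1 == v.1.1) && (u.1.2 == v.1.2)).
have fuv : f u != f v by rewrite (inj_eq finj).
(* Distinct points of one line are always adjacent; across lines, adjacency is [loceq], that is,
   equality of the first coordinates. *)
have [E2|n2] /= := eqVneq u.1.2 v.1.2.
  by rewrite !andbT andbF orbN (line_edge (LC u.1.2)) // E2 fL.
have vLu : f v \notin L u.1.2.
  apply: (lines_meet (ef v) (LC v.1.2)) => //.
  by apply: contraNneq n2 => /Linj ->.
rewrite -(loceq_edge (ef u) (ef v) (LC u.1.2)) // !andbF andbT orbF /=.
have fuN : f u \in [set y | e x y] by rewrite inE.
have fvN : f v \in [set y | e x y] by rewrite inE.
rewrite -(pblock_equivalence_partition (@loceq_equiv x) fuN fvN) -/(locclasses x) -/P.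
rewrite (same_class _ _ (fB u)).
apply/idP/eqP => [fvB|->]; last exact: fB.
by apply: Binj; rewrite -(same_class _ _ fvB) (same_class _ _ (fB v)).
Qed.

End LocalStructure.

(** * Standard sequence and Delsarte cliques *)

Section DistanceRegular.
#[local] Set Implicit Arguments.
#[local] Unset Strict Implicit.
#[local] Open Scope ring_scope.

Variables (n : nat) (e : rel 'I_n) (D : nat) (bi ci : nat -> nat).
Hypothesis dr : distance_regular e D bi ci.

Implicit Types x y z : 'I_n.

Let e_sym : symmetric e. Proof. by case: dr => -[]. Qed.
Let e_irr : irreflexive e. Proof. by case: dr => -[]. Qed.

(** * Distances and intersection numbers *)

Definition dist x y := find (fun i => y \in ball e x i) (iota 0 D.+1).

Lemma ball_mono x i j : (i <= j)%N -> ball e x i \subset ball e x j.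
Proof.
move=> /subnK <-; elim: (j - i)%N => //= m IH.
by apply: subset_trans IH _; apply: subsetUl.
Qed.

Lemma mem_ball x y i : (y \in ball e x i) = (dist x y <= i)%N.
Proof.
have yD : y \in ball e x D by case: dr.
(* The search succeeds by radius [D], so [find] returns a genuine radius and not the length of the
   list. *)
have hasD : has (fun i => y \in ball e x i) (iota 0 D.+1).
  by apply/hasP; exists D; rewrite // mem_iota /= add0n ltnS.
have ltD : (dist x y < D.+1)%N by rewrite -[X in (_ < X)%N](size_iota 0) -has_find.
apply/idP/idP => [yi|le]; last first.
  apply: (subsetP (ball_mono x le)).
  by have := nth_find 0%N hasD; rewrite nth_iota // add0n.
rewrite leqNgt; apply/negP=> lt.
have := before_find 0%N lt; rewrite nth_iota ?add0n ?yi //.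
exact: ltn_trans ltD.
Qed.

Lemma dist_le x y : (dist x y <= D)%N.
Proof. by rewrite -mem_ball; case: dr. Qed.

Lemma dist_isE x y i : dist_is e x y i = (dist x y == i).
Proof.
rewrite /dist_is mem_ball; case: i => [|i]; first by rewrite leqn0 andbT.
by rewrite mem_ball -ltnNge eqn_leq.
Qed.

Lemma dist_eq0 x y : (dist x y == 0%N) = (x == y).
Proof. by rewrite -leqn0 -mem_ball inE eq_sym. Qed.

Lemma distxx x : dist x x = 0%N.
Proof. by apply/eqP; rewrite dist_eq0. Qed.

Lemma dist_edge x y z : e y z -> (dist x z <= (dist x y).+1)%N.
Proof.
move=> eyz; rewrite -mem_ball /= !inE; apply/orP; right.
by apply/existsP; exists y; rewrite mem_ball leqnn.
Qed.

Lemma dist1 x y : (dist x y == 1%N) = e x y.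
Proof.
apply/idP/idP => [/eqP d1|exy].
  have : y \in ball e x 1 by rewrite mem_ball d1.
  rewrite /= !inE => /orP[/eqP yx|/existsP[z]]; first by rewrite yx distxx in d1.
  by rewrite inE => /andP[/eqP->].
rewrite eqn_leq lt0n dist_eq0; have := dist_edge x exy; rewrite distxx => -> /=.
by apply: contraTneq exy => ->; rewrite e_irr.
Qed.

Lemma card_nbr_succ x y :
  #|[set z | e y z & dist x z == (dist x y).+1]| = bi (dist x y).
Proof.
case: dr => _ _ _ /(_ x y (dist x y)) <-; rewrite ?dist_le ?dist_isE // => _.
by apply: eq_card => z; rewrite !inE dist_isE andbC.
Qed.

Lemma card_nbr_pred x y : (0 < dist x y)%N ->
  #|[set z | e y z & dist x z == (dist x y).-1]| = ci (dist x y).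
Proof.
move=> d0; case: dr => _ _ _ _ /(_ x y (dist x y)) <-; rewrite ?dist_le ?dist_isE ?d0 //.
by apply: eq_card => z; rewrite !inE dist_isE andbC.
Qed.

Lemma valency y : #|[set z | e y z]| = bi 0.
Proof.
rewrite -(distxx y) -card_nbr_succ; apply: eq_card => z.
by rewrite !inE distxx dist1 andbb.
Qed.

(** The differences keep the number of neighbours at equal distance out of the formula. At [i = 0]
    the predecessor is [0] again and the last term vanishes. *)
Lemma nbr_sum (V : zmodType) (g : nat -> V) x y :
  let i := dist x y in
  \sum_(z | e y z) g (dist x z) =
    g i *+ bi 0 + (g i.+1 - g i) *+ bi i + (g i.-1 - g i) *+ ci i.
Proof.
move=> i.
have -> : (g i.-1 - g i) *+ ci i =
    \sum_(z | e y z && (dist x z == i.-1)) (g i.-1 - g i).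
  have [i0|i0] := posnP i.
    by rewrite i0 subrr mul0rn big1.
  by rewrite -(card_nbr_pred i0) -sumr_const; apply: eq_bigl => z; rewrite inE.
have -> : (g i.+1 - g i) *+ bi i =
    \sum_(z | e y z && (dist x z == i.+1)) (g i.+1 - g i).
  by rewrite -card_nbr_succ -sumr_const; apply: eq_bigl => z; rewrite inE.
have -> : g i *+ bi 0 = \sum_(z | e y z) g i.
  by rewrite -(valency y) -sumr_const; apply: eq_bigl => z; rewrite inE.
rewrite !big_mkcondr -!big_split /=; apply: eq_bigr => z eyz.
have le1 := dist_edge x eyz.
have le2 : (i <= (dist x z).+1)%N by rewrite dist_edge // e_sym.
have [->|n1] := eqVneq (dist x z) i.+1.
  by rewrite gtn_eqF ?ltnS ?leq_pred // addr0 addrC subrK.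
have [->|n2] := eqVneq (dist x z) i.-1; first by rewrite addr0 addrC subrK.
rewrite !addr0; congr g; apply/eqP; rewrite eqn_leq -ltnS ltn_neqAle n1 le1 /=.
by move: n2 le2; case: (i) => //= j; rewrite ltnS leq_eqVlt eq_sym => /negPf->.
Qed.

(** Stepping back along a shortest path from a vertex at distance [D] reaches one at distance
    [i.+1]; its predecessor on the path has a neighbour farther out. *)
Lemma bi_gt0 i : (i < D)%N -> (0 < bi i)%N.
Proof.
move=> ltiD; case: dr => _ _ [x [y0]]; rewrite dist_isE => /eqP dy0 _ _.
have step y j : dist x y = j.+1 -> exists2 z, dist x z = j & e z y.
  move=> dy; have : y \in ball e x j.+1 by rewrite mem_ball dy.
  rewrite /= inE mem_ball dy ltnn /= inE => /existsP[z].
  rewrite mem_ball => /andP[le ezy]; exists z => //.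
  by apply/eqP; rewrite eqn_leq le -ltnS -dy dist_edge.
have [y dy] : exists y, dist x y = i.+1.
  rewrite -(subKn ltiD); elim: (D - i.+1)%N => [|m [y IH]].
    by exists y0; rewrite subn0.
  have [lt|ge] := ltnP m D; last first.
    by exists y; rewrite IH; move: ge (leqW ge); rewrite -!subn_eq0 => /eqP-> /eqP->.
  have [z dz _] : exists2 z, dist x z = (D - m.+1)%N & e z y.
    by apply: step; rewrite IH -subSn // subSS.
  by exists z.
have [z dz ezy] := step y i dy.
rewrite -{1}dz -card_nbr_succ; apply/card_gt0P; exists y.
by rewrite inE ezy dy dz eqxx.
Qed.

(** For the indicator of [j], the right side of [nbr_sum] depends on [y] only through its distance.
    This covers neighbours at equal distance too. *)
Lemma card_nbr_dist x y y' j : dist x y = dist x y' ->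
  #|[set z | e y z & dist x z == j]| = #|[set z | e y' z & dist x z == j]|.
Proof.
move=> E; apply/eqP; rewrite -(eqr_nat rat).
have cnt u : (#|[set z | e u z & dist x z == j]|)%:R =
    \sum_(z | e u z) (dist x z == j)%:R :> rat.
  rewrite -sumr_const (eq_bigl (fun z => e u z && (dist x z == j))); last first.
    by move=> z; rewrite inE.
  by rewrite big_mkcondr; apply: eq_bigr => z _; case: eqP.
by rewrite !cnt !(nbr_sum (fun i => (i == j)%:R)) E.
Qed.


(** * Classical parameters and the standard sequence *)

Variables (b : nat) (alpha beta : rat).
Hypothesis cp : classical_params D b alpha beta bi ci.
Hypothesis alpha_ge0 : 0 <= alpha.
Hypothesis D_gt0 : (0 < D)%N.

Local Notation br i := ((gbr b i)%:R : rat).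

Lemma valency_classical : (bi 0)%:R = br D * beta.
Proof. by case: cp => -> // _; rewrite /gbr big_ord0 subr0 mulr0 subr0. Qed.

Lemma gbr_mono i j : (i <= j)%N -> (gbr b i <= gbr b j)%N.
Proof.
move=> /subnKC <-; rewrite /gbr big_split_ord /=; exact: leq_addr.
Qed.

(** This is one factor of the positive number [bi i], and the other factor is nonnegative. *)
Lemma beta_gt i : (i < D)%N -> 0 < beta - alpha * br i.
Proof.
move=> lti; have := bi_gt0 lti; rewrite -(ltr0n rat); have [/(_ i (ltnW lti)) -> _] := cp.
have : 0 <= br D - br i by rewrite subr_ge0 ler_nat gbr_mono // ltnW.
rewrite le_eqVlt => /predU1P[<-|lt0]; first by rewrite mul0r ltxx.
by rewrite pmulr_rgt0.
Qed.

Lemma beta_gt0 : 0 < beta.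
Proof. by have := beta_gt D_gt0; rewrite /gbr big_ord0 mulr0 subr0. Qed.

Lemma gbrD_gt0 : (0 < gbr b D)%N.
Proof.
have := bi_gt0 D_gt0; rewrite -(ltr0n rat) valency_classical.
by rewrite pmulr_lgt0 ?beta_gt0 // ltr0n.
Qed.

(* The standard sequence of the eigenvalue [- gbr b D] is [(-1) ^+ i * stdabs i]. *)
Definition stdabs i : rat :=
  \prod_(j < i) ((1 + alpha * br j) / (beta - alpha * br j)).

Definition stdseq i : rat := (-1) ^+ i * stdabs i.

Lemma stdabs_gt0 i : (i <= D)%N -> 0 < stdabs i.
Proof.
move=> leiD; apply: prodr_gt0 => j _; apply: divr_gt0.
  by rewrite ltr_wpDr // mulr_ge0 // ler0n.
exact/beta_gt/(leq_trans (ltn_ord j)).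
Qed.

Lemma stdseqS i : (i < D)%N ->
  (beta - alpha * br i) * stdseq i.+1 = - (1 + alpha * br i) * stdseq i.
Proof.
move=> lti; rewrite /stdseq /stdabs big_ord_recr exprS /=.
have := beta_gt lti; set c := beta - _ => c0.
by field; rewrite gt_eqF.
Qed.

(** [stdseqS] turns the terms at distances [i.+1] and [i.-1] into multiples of [stdseq i]. They
    combine because [beta - alpha * br j] and [1 + alpha * br j] add up to [1 + beta] for every
    [j]. *)
Lemma stdseq_eigen x y :
  \sum_(z | e y z) stdseq (dist x z) = - br D * stdseq (dist x y).
Proof.
rewrite nbr_sum; have := dist_le x y; set i := dist x y => leiD.
rewrite -[_ *+ bi 0]mulr_natr -[_ *+ bi i]mulr_natr -[_ *+ ci i]mulr_natr.
rewrite valency_classical.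
have [bE cE] := cp; rewrite (bE i leiD).
have up : (br D - br i) * (beta - alpha * br i) * stdseq i.+1 =
    - (br D - br i) * (1 + alpha * br i) * stdseq i.
  (* [stdseqS] stops before [D], where the factor [br D - br i] is zero. *)
  have [->|ltiD] := eqVneq i D; first by rewrite !subrr oppr0 !mul0r.
  by rewrite -mulrA stdseqS ?ltn_neqAle ?ltiD //; ring.
have down : (stdseq i.-1 - stdseq i) * (ci i)%:R =
    - br i * (beta - alpha * br i.-1) * stdseq i
    - br i * (1 + alpha * br i.-1) * stdseq i.
  case: (i) leiD => [|j] leiD; first by rewrite subrr /gbr big_ord0; ring.
  rewrite (cE j.+1) //= mulrBl; have := stdseqS leiD.
  move=> E; rewrite -mulrA -mulrA E; ring.
rewrite down [(stdseq i.+1 - _) * _]mulrC mulrBr up; ring.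
Qed.

(** * The smallest eigenvalue *)

Lemma mulmx_adj (w : 'rV[algC]_n) y :
  (w *m adjmx e) 0 y = \sum_(z | e y z) w 0 z.
Proof.
rewrite mxE [RHS]big_mkcond; apply: eq_bigr => z _.
by rewrite mxE e_sym; case: (e y z); rewrite ?mulr1 ?mulr0.
Qed.

Lemma eigenvalue_gbr x : eigenvalue (adjmx e) (- (gbr b D)%:R).
Proof.
apply/eigenvalueP; exists (\row_y ratr (stdseq (dist x y))).
  apply/rowP=> y; rewrite mulmx_adj !mxE.
  rewrite (eq_bigr (fun z => ratr (stdseq (dist x z)) : algC)); last first.
    by move=> z _; rewrite mxE.
  by rewrite -rmorph_sum stdseq_eigen rmorphM rmorphN /= ratr_nat.
apply/rV0Pn; exists x; rewrite mxE distxx fmorph_eq0.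
by rewrite /stdseq /stdabs big_ord0 expr0 mulr1 oner_eq0.
Qed.

(** Consecutive distances carry opposite signs, so removing the signs from [stdseq_eigen] moves the
    equal-distance term across and leaves nonnegative coefficients only. *)
Lemma stdabs_nbr x y :
  \sum_(z | e y z && (dist x z != dist x y)) stdabs (dist x z) =
  (br D + (#|[set z | e y z & dist x z == dist x y]|)%:R) * stdabs (dist x y).
Proof.
have := stdseq_eigen x y.
rewrite (bigID (fun z => dist x z == dist x y)) /=.
rewrite (eq_bigr (fun _ => stdseq (dist x y))); last first.
  by move=> z /andP[_ /eqP->].
rewrite (eq_bigl (fun z => z \in [set z | e y z & dist x z == dist x y])); last first.
  by move=> z; rewrite inE.
rewrite sumr_const.
have -> : \sum_(z | e y z && (dist x z != dist x y)) stdseq (dist x z) =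
   - ((-1) ^+ dist x y * \sum_(z | e y z && (dist x z != dist x y)) stdabs (dist x z)).
  rewrite mulr_sumr -sumrN; apply: eq_bigr => z /andP[eyz nz].
  rewrite /stdseq -mulNr; congr (_ * _).
  have le1 := dist_edge x eyz.
  have le2 : (dist x y <= (dist x z).+1)%N by rewrite dist_edge // e_sym.
  have [lt|lt|eq] := ltngtP (dist x z) (dist x y).
  - have -> : dist x y = (dist x z).+1 by apply/eqP; rewrite eqn_leq le2 lt.
    by rewrite exprS mulN1r opprK.
  - have -> : dist x z = (dist x y).+1 by apply/eqP; rewrite eqn_leq le1 lt.
    by rewrite exprS mulN1r.
  by rewrite eq eqxx in nz.
rewrite /stdseq -[_ *+ #|_|]mulr_natr.
set S := \sum_(_ | _) _; set m := _%:R; set p := stdabs _ => E.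
have sq : (-1) ^+ dist x y * (-1) ^+ dist x y = 1 :> rat by rewrite -expr2 sqrr_sign.
have {}E : (-1) ^+ dist x y * S = (-1) ^+ dist x y * ((br D + m) * p).
  apply/eqP; rewrite -subr_eq0 -oppr_eq0; apply/eqP.
  by move/eqP: E; rewrite -subr_eq0 => /eqP <-; ring.
by rewrite -[S]mul1r -sq -mulrA E mulrA sq mul1r.
Qed.

(* Perron-Frobenius for the tridiagonal intersection matrix with the sign
   pattern [(-1) ^+ i] removed: the sums of an eigenvector over the spheres
   around [x] are compared with the positive vector [stdabs]. *)
Lemma eigenvalue_ge theta : theta \is Num.real ->
  eigenvalue (adjmx e) theta -> - (gbr b D)%:R <= theta.
Proof.
move=> theta_real /eigenvalueP[w wA /rV0Pn[x wx]].
pose P i : algC := ratr (stdabs i).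
pose W j := \sum_(z | dist x z == j) w 0 z.
(* [t] is the intersection matrix, read off at one vertex of each sphere; the default [x] stands in
   for an empty sphere, where [W] is zero. *)
pose rep i := odflt x [pick y | dist x y == i].
pose t i j := #|[set z | e (rep i) z & dist x z == j]|.
have repE y : dist x y = dist x (rep (dist x y)).
  rewrite /rep; case: pickP => [z /eqP //|/(_ y)]; by rewrite eqxx.
have tE y j : #|[set z | e y z & dist x z == j]| = t (dist x y) j.
  exact: card_nbr_dist.
have ltd z : (dist x z < D.+1)%N by rewrite ltnS dist_le.
pose od z : 'I_D.+1 := Ordinal (ltd z).
have eqW j : theta * W j = \sum_(i < D.+1) W i * (t i j)%:R.
  rewrite mulr_sumr (eq_bigr (fun y => \sum_(z | e y z) w 0 z)); last first.
    by move=> y _; rewrite -mulmx_adj wA mxE.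
  rewrite (exchange_big_dep xpredT) //= (partition_big od xpredT) //=.
  apply: eq_bigr => i _; rewrite mulr_suml.
  apply: eq_big => // z /eqP zi; rewrite -zi /= -tE mulr_natr -sumr_const.
  by apply: eq_bigl => y; rewrite inE e_sym andbC.
have W0 i : (forall y, dist x y != i) -> W i = 0.
  by move=> noi; rewrite /W big_pred0 // => y; apply: negPf.
have rowP i : (exists y, dist x y = i) ->
    \sum_(j < D.+1 | j != i :> nat) (t i j)%:R * P j =
    ((gbr b D)%:R + (t i i)%:R) * P i.
  case=> y <-; have := congr1 (ratr : rat -> algC) (stdabs_nbr x y).
  rewrite rmorphM rmorphD /= !ratr_nat tE => <-.
  rewrite rmorph_sum /= (partition_big od (fun j => j != dist x y :> nat)) /=; last first.
    by move=> z /andP[].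
  apply: eq_bigr => j nj; rewrite -tE mulr_natl -sumr_const.
  apply: eq_big => [z|z].
    rewrite inE -val_eqE /=; case: eqP => [->|]; last by rewrite !andbF.
    by rewrite nj !andbT.
  by rewrite inE => /andP[_ /eqP ->].
(* Isolate the diagonal term of [eqW] and apply the triangle inequality to the rest. *)
have ineq (j : 'I_D.+1) : ((t j j)%:R - theta) * `|W j| <=
    \sum_(i < D.+1 | j != i :> nat) `|W i| * (t i j)%:R.
  have := eqW j; rewrite (bigD1 j) //= => E.
  apply: le_trans (_ : `|(t j j)%:R - theta| * `|W j| <= _).
    by rewrite ler_wpM2r // real_ler_norm // realB // realn.
  have {}E : (theta - (t j j)%:R) * W j =
      \sum_(i < D.+1 | i != j) W i * (t i j)%:R.
    by rewrite mulrBl E; ring.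
  rewrite distrC -normrM E (le_trans (ler_norm_sum _ _ _)) //.
  rewrite le_eqVlt; apply/orP; left; apply/eqP.
  apply: eq_big => [i|i _]; first by rewrite eq_sym.
  by rewrite normrM normr_nat.
have Pge0 (j : 'I_D.+1) : 0 <= P j.
  by rewrite ler0q ltW // stdabs_gt0 // -ltnS.
(* Sum [ineq] with weights [P j]: after exchanging the sums, [rowP] evaluates the inner one and the
   diagonal entries cancel. *)
have total : (- theta - (gbr b D)%:R) * \sum_(j < D.+1) P j * `|W j| <= 0.
  have : \sum_(j < D.+1) P j * (((t j j)%:R - theta) * `|W j|) <=
      \sum_(i < D.+1) `|W i| * (((gbr b D)%:R + (t i i)%:R) * P i).
    apply: le_trans (ler_sum _ (fun j _ => ler_wpM2l (Pge0 j) (ineq j))) _.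
    rewrite (eq_bigr _ (fun j _ => mulr_sumr _ _ _ _)).
    rewrite (exchange_big_dep xpredT) //= le_eqVlt; apply/orP; left; apply/eqP.
    apply: eq_bigr => i _.
    have [|Wi] := eqVneq (W i) 0.
      by move=> ->; rewrite normr0 mul0r big1 // => j _; rewrite mul0r mulr0.
    rewrite -rowP; last first.
      have [y /eqP yi|noi] := pickP (fun y => dist x y == i :> nat); first by exists y.
      by case/eqP: Wi; apply: W0 => y; rewrite noi.
    by rewrite mulr_sumr; apply: eq_bigr => j _; ring.
  rewrite -subr_ge0 -sumrB mulr_sumr -oppr_ge0 -sumrN.
  by congr (_ <= _); apply: eq_bigr => j _; ring.
(* The sphere of radius [0] contributes the absolute value of [w 0 x], nonzero by the choice of
   [x]. *)
have pos : 0 < \sum_(j < D.+1) P j * `|W j|.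
  rewrite (bigD1 ord0) //=; apply: ltr_pwDl; last first.
    by apply: sumr_ge0 => j _; rewrite mulr_ge0.
  rewrite /P /stdabs big_ord0 rmorph1 mul1r normr_gt0 /W (big_pred1 x) // => y.
  by rewrite dist_eq0 eq_sym.
move: total; rewrite pmulr_lle0 // subr_le0 => le.
by rewrite lerNl.
Qed.

Lemma smallest_eigenvalue_gbr theta :
  smallest_eigenvalue e theta -> theta = - (gbr b D)%:R.
Proof.
case=> ev min; have [_ _ [x _] _ _] := dr; have le := min _ (eigenvalue_gbr x).
apply/eqP; rewrite eq_le le /= eigenvalue_ge //.
(* In [algC], being comparable with a real number makes [theta] real. *)
by rewrite -(ger_real le) // realN realn.
Qed.

Lemma card_delsarte L : delsarte_clique e (bi 0) L -> (#|L|)%:R = 1 + beta.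
Proof.
case=> _ [theta [theta_min cardL]].
apply: (fmorph_inj (ratr : rat -> algC)).
rewrite /= ratr_nat cardL (smallest_eigenvalue_gbr theta_min) opprK.
rewrite rmorphD rmorph1 /= -(ratr_nat _ (bi 0)) valency_classical rmorphM /= ratr_nat.
by rewrite mulrAC mulfV ?mul1r // pnatr_eq0 -lt0n gbrD_gt0.
Qed.

(** * Counting on the lines *)

Variable CC : {set {set 'I_n}}.
Hypothesis geo : geometric e (bi 0) CC.

Lemma card_line L : L \in CC -> (#|L|)%:R = 1 + beta.
Proof. by case: geo => del _ /del; apply: card_delsarte. Qed.

Lemma line_adj L x y : L \in CC -> x \in L -> y \in L -> x != y -> e x y.
Proof.
case: geo => del _ /del[/forall_inP cL _] xL yL xy.
by move/forall_inP: (cL x xL) => /(_ y yL)/implyP; apply.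
Qed.

Lemma line_through x y : e x y -> exists2 L, L \in CC & (x \in L) && (y \in L).
Proof.
by case: geo => _ ex /ex [L [[LC [xL yL]] _]]; exists L; rewrite // xL yL.
Qed.

Lemma line_unique x y L L' : e x y -> L \in CC -> L' \in CC ->
  x \in L -> y \in L -> x \in L' -> y \in L' -> L = L'.
Proof.
by case: geo => _ ex /ex [K [_ u]] LC LC' xL yL xL' yL'; rewrite -(u L) ?(u L').
Qed.

(** This is the action of the product of the incidence matrix and its transpose: a vertex [z != y]
    shares exactly one line with [y] if adjacent to it, and none otherwise. *)
Lemma sum_lines (V : zmodType) (F : 'I_n -> V) y :
  \sum_(L in CC | y \in L) \sum_(z in L) F z =
  F y *+ #|[set L in CC | y \in L]| + \sum_(z | e y z) F z.
Proof.
rewrite (eq_bigr (fun L : {set 'I_n} => F y + \sum_(z in L | z != y) F z)); last first.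
  by move=> L /andP[_ yL]; rewrite (bigD1 y).
rewrite big_split /= -sumr_const; congr (_ + _).
  by apply: eq_bigl => L; rewrite inE.
rewrite (exchange_big_dep (e y)) /=; last first.
  move=> L z /andP[LC yL] /andP[zL zy]; apply: (line_adj LC) => //.
  by rewrite eq_sym.
apply: eq_bigr => z eyz; have [L LC /andP[yL zL]] := line_through eyz.
rewrite (big_pred1 L) // => K /=; apply/idP/eqP => [/and3P[/andP[KC yK] zK _]|->].
  exact: (line_unique eyz).
by rewrite LC yL zL /= eq_sym; apply: contraTneq eyz => ->; rewrite e_irr.
Qed.

(** For constant [1] in [sum_lines], each line contributes [1 + beta] and the neighbours
    [br D * beta]; cancelling [beta] leaves the count. *)
Lemma card_lines y : #|[set L in CC | y \in L]| = gbr b D.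
Proof.
apply/eqP; rewrite -(eqr_nat rat); apply/eqP.
have := sum_lines (fun _ => 1 : rat) y.
rewrite (eq_bigr (fun L : {set 'I_n} => 1 + beta)); last first.
  by move=> L /andP[LC _]; rewrite sumr_const card_line.
rewrite (eq_bigl (fun L => L \in [set L in CC | y \in L])); last first.
  by move=> L; rewrite inE.
rewrite (eq_bigl (fun z => z \in [set z | e y z])); last by move=> z; rewrite inE.
rewrite !sumr_const valency valency_classical -[_ *+ #|_|]mulr_natl mulrDr mulr1.
by move/addrI/(mulIf (lt0r_neq0 beta_gt0)).
Qed.

(* With [N] the point-line incidence matrix, [N *m N^T = adjmx e + (gbr b D)%:M]
   kills the standard vector, hence so does [N^T]. *)
Lemma stdseq_line x L : L \in CC -> \sum_(y in L) stdseq (dist x y) = 0.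
Proof.
pose S (K : {set 'I_n}) := \sum_(y in K) stdseq (dist x y).
have sum0 : \sum_(K in CC) S K ^+ 2 = 0.
  rewrite (eq_bigr (fun K : {set _} => \sum_(y in K) stdseq (dist x y) * S K)); last first.
    by move=> K _; rewrite -mulr_suml expr2.
  rewrite (exchange_big_dep xpredT) //= big1 // => y _.
  rewrite -mulr_sumr sum_lines card_lines stdseq_eigen.
  by rewrite -[stdseq _ *+ _]mulr_natl mulNr addrN mulr0.
move=> LC; have /eqP := psumr_eq0P (fun K _ => sqr_ge0 (S K)) sum0 LC.
by rewrite sqrf_eq0 => /eqP.
Qed.

(** The points of [L] are at distance 1 or 2 from [x]. The zero sum of [stdseq] on [L] and the
    recurrence at [1] fix the ratio of the two counts, whose sum is [1 + beta]. *)
Lemma card_line_nbrs L x : (1 < D)%N -> L \in CC -> x \notin L ->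
  (exists2 y, y \in L & e x y) -> (#|[set z in L | e x z]|)%:R = alpha + 1.
Proof.
move=> D2 LC xL [y0 y0L exy0]; have := stdseq_line x LC.
rewrite (bigID (e x)) /=.
rewrite (eq_bigr (fun _ => stdseq 1)); last first.
  by move=> y /andP[_]; rewrite -dist1 => /eqP->.
rewrite [X in _ + X](eq_bigr (fun _ => stdseq 2)); last first.
  move=> y /andP[yL nxy]; congr stdseq; apply/eqP.
  have y0y : y0 != y by apply: contraNneq nxy => <-.
  have := dist_edge x (line_adj LC y0L yL y0y).
  rewrite -dist1 in exy0; rewrite (eqP exy0) leq_eqVlt => /predU1P[->//|].
  rewrite ltnS leq_eqVlt dist1 (negPf nxy) ltnS leqn0 dist_eq0 /=.
  by move=> /eqP xy; rewrite xy yL in xL.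
rewrite (eq_bigl (fun z => z \in [set z in L | e x z])); last by move=> z; rewrite inE.
rewrite [X in _ + X](eq_bigl (fun z => z \in L :\: [set z in L | e x z])); last first.
  by move=> z; rewrite !inE; case: (z \in L); rewrite ?andbT ?andbF.
rewrite !sumr_const.
have cards := cardsID [set z in L | e x z] L.
have := card_line LC; rewrite -cards natrD.
have -> : L :&: [set z in L | e x z] = [set z in L | e x z].
  by apply/setIidPr/subsetP=> z; rewrite inE => /andP[].
rewrite -[stdseq 1 *+ _]mulr_natl -[stdseq 2 *+ _]mulr_natl.
set J := _%:R; set K := _%:R => JK sum0.
have U1 : stdseq 1 != 0.
  by rewrite mulf_neq0 ?signr_eq0 // gt_eqF // stdabs_gt0.
have := stdseqS D2; have -> : gbr b 1 = 1%N by rewrite /gbr big_ord1.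
rewrite mulr1 => E.
have {}sum0 : (J * (beta - alpha) - K * (1 + alpha)) * stdseq 1 = 0.
  transitivity ((beta - alpha) * (J * stdseq 1 + K * stdseq 2)); last by rewrite sum0 mulr0.
  have -> : (beta - alpha) * (J * stdseq 1 + K * stdseq 2) =
      (beta - alpha) * J * stdseq 1 + K * ((beta - alpha) * stdseq 2) by ring.
  by rewrite E; ring.
move/eqP: sum0; rewrite mulf_eq0 (negPf U1) orbF => /eqP sum0.
have KE : K = 1 + beta - J by rewrite -JK; ring.
have : (1 + beta) * (J - (alpha + 1)) = 0 by rewrite -sum0 KE; ring.
move/eqP; rewrite mulf_eq0 gt_eqF ?ltr_wpDr ?ltW ?beta_gt0 //= subr_eq0.
by move/eqP.
Qed.

End DistanceRegular.

Theorem theorem24 (n : nat) (e : rel 'I_n) (D b : nat) (alpha beta : rat)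
  (bi ci : nat -> nat) (CC : {set {set 'I_n}}) :
  distance_regular e D bi ci ->
  classical_params D b alpha beta bi ci ->
  (2 <= b)%N -> (1 <= alpha)%R -> (alpha <= (b%:R - 1 : rat))%R -> (3 <= D)%N ->
  geometric e (bi 0%N) CC ->
  dual_pasch e CC ->
  [/\ (forall (L M : {set 'I_n}), L \in CC -> assembly e CC M ->
         L :&: M != set0 -> ((#|L :&: M|)%:R = alpha + 1 :> rat)%R),
      (forall (M : {set 'I_n}) (u : 'I_n), assembly e CC M -> u \notin M ->
         (exists2 w, w \in M & e u w) ->
         ((#|[set w in M | e u w]|)%:R = alpha + 1 :> rat)%R /\
         (exists! L, L \in CC /\ u \in L /\ L :&: M != set0)) &
      (forall x : 'I_n, exists s m : nat,
         [/\ (s%:R = alpha)%R, (m%:R = beta / alpha :> rat)%R &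
             local_is_clique_ext_grid e x s m (gbr b D)])].
Proof.
move=> dr cp b2 alpha1 _ D3 geo dp.
have [[e_sym e_irr] _ [x0 _] _ _] := dr.
have D_gt0 : 0 < D by apply: leq_trans D3.
have alpha_ge0 : (0 <= alpha)%R by apply: le_trans alpha1.
have lines := card_lines dr cp alpha_ge0 D_gt0 geo.
have cardL := card_line dr cp alpha_ge0 D_gt0 geo.
have nbrs L x := card_line_nbrs dr cp alpha_ge0 D_gt0 geo (ltnW D3) (L := L) (x := x).
have ex := line_through geo.
have uniq := line_unique geo.
(* Already [gbr b 2], which is [1 + b], is at least 3. *)
have r_gt2 : 2 < gbr b D.
  apply: leq_trans (gbr_mono b (ltnW D3)).
  by rewrite /gbr 2!big_ord_recl big_ord0 addn0 expn0 expn1 add1n ltnS.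
(* [alpha] and [beta] are only known to be rational. An edge and a second line through [x0] realise
   [alpha + 1] and [1 + beta] as cardinals, making both natural numbers. *)
have [y0 exy0] : exists y, e x0 y.
  have : 0 < #|[set z | e x0 z]| by rewrite (valency dr) (bi_gt0 dr).
  by case/card_gt0P=> y; rewrite inE => exy; exists y.
have [L0 L0C /andP[xL0 yL0]] := ex _ _ exy0.
have [L1 L1C /andP[xL1 yL1]] :
    exists2 L, L \in CC & (x0 \in L) && (y0 \notin L).
  have : 0 < #|[set L in CC | x0 \in L] :\ L0|.
    by have := lines x0; rewrite (cardsD1 L0) inE L0C xL0 add1n => E; rewrite -ltnS E ltnW.
  case/card_gt0P=> L; rewrite !inE => /and3P[neL LC xL]; exists L; rewrite // xL /=.
  by apply: contraNN neL => yL; rewrite (uniq _ _ _ _ exy0 LC L0C xL yL xL0 yL0).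
pose a := #|[set z in L1 | e y0 z]|.-1.
have aE : alpha = (a%:R)%R.
  have J : (#|[set z in L1 | e y0 z]|%:R = alpha + 1 :> rat)%R.
    by apply: nbrs => //; exists x0; rewrite // e_sym.
  apply: (addIr (1 : rat)%R); rewrite -J -mulrSr prednK // -(ltr0n rat) J.
  by rewrite ltr_wpDl.
pose q := #|L0|.-1.
have qE : beta = (q%:R)%R.
  apply: (addrI (1 : rat)%R); rewrite -(cardL _ L0C) addrC -mulrSr prednK //.
  by apply/card_gt0P; exists x0.
have a_gt0 : 0 < a by rewrite -(ltr0n rat) -aE (lt_le_trans ltr01).
have line_card L : L \in CC -> #|L| = q.+1.
  by move=> LC; apply/eqP; rewrite -(eqr_nat rat) cardL // qE mulrSr addrC.
have line_nbrs L x : L \in CC -> x \notin L ->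
    (exists2 y, y \in L & e x y) -> #|[set z in L | e x z]| = a.+1.
  by move=> LC xL exyL; apply/eqP; rewrite -(eqr_nat rat) nbrs // aE mulrSr.
have line_clique L : L \in CC -> clique e L by case: geo => del _ /del[].
have alphaS : (a.+1%:R = alpha + 1 :> rat)%R by rewrite aE mulrSr.
split.
- move=> L M LC aM LM; rewrite -alphaS.
  by rewrite (line_assembly e_sym e_irr line_clique ex uniq line_nbrs a_gt0 lines r_gt2 dp).
- move=> M u aM uM uw; rewrite -alphaS.
  have [-> //] := assembly_nbrs e_sym e_irr line_clique ex uniq line_nbrs a_gt0 lines
    r_gt2 dp aM uM uw.
move=> x; exists a, #|locclasses e CC x|; split=> //.
  rewrite aE qE (card_locclasses e_sym e_irr line_clique line_card ex uniq line_nbrs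
    a_gt0 lines r_gt2 dp x).
  by rewrite natrM mulfK // pnatr_eq0 -lt0n.
exact: (local_grid e_sym e_irr line_clique ex uniq line_nbrs a_gt0 lines r_gt2 dp).
Qed.
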